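(* Let $X$ be an infinite-dimensional Fréchet space without continuous norm, whose topology is given by an increasing sequence of seminorms $(p_n)_{n\ge1}$, let $Y$ be a separable topological vector space whose topology is given by an increasing sequence of seminorms $(q_j)_{j\ge1}$, and let $(T_k)_{k\ge1}$ be a sequence of continuous linear operators from $X$ to $Y$. For $j\ge1$ let $$X_j=\{x\in X:\ \#\{k:q_j(T_kx)=0\}=\infty\}.$$ If there exist $j,N,K\ge1$ and a subspace $E$ of finite codimension in $X$ such that $$\bigcup_{k\ge K}T_k\big(\ker p_N\cap E\cap X_j\big)$$ is not dense in $Y$, then $(T_k)$ does not possess any hypercyclic subspace of type $2$.
   Context: A vector $x\in X$ is hypercyclic for a sequence $(T_k)$ of operators from $X$ to $Y$ if $\{T_kx\}_k$ is dense in $Y$. A hypercyclic subspace for $(T_k)$ is a closed infinite-dimensional subspace $M$ of $X$ in which every non-zero vector is hypercyclic for $(T_k)$. A hypercyclic subspace $M$ is of type $2$ if for any continuous seminorm $p$ on $X$, the subspace $M\cap\ker p$ is infinite-dimensional. A continuous norm on $X$ is a continuous seminorm $p$ on $X$ with $\ker p=\{0\}$. $\#S$ denotes the cardinality of $S$. *)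

(* Defs.v *)
From HB Require Import structures.
From mathcomp Require Import all_boot all_order all_algebra.
From mathcomp Require Import complex.
From mathcomp Require Import all_classical all_reals all_analysis.

Set Implicit Arguments.
Unset Strict Implicit.
Unset Printing Implicit Defensive.

Import Order.TTheory GRing.Theory Num.Theory.
Import numFieldNormedType.Exports.

Local Open Scope classical_set_scope.
Local Open Scope ring_scope.

(* Spaces are over K = the real or the complex numbers.  As with `|_| on a
   normed module over K, seminorms take values in K itself: when K = R[i],
   [0 <= p x] says that [p x] is a nonnegative real. *)
Variant scalar_field (R : realType) : numFieldType -> Prop :=
  | real_scalars : scalar_field R R
  | complex_scalars : scalar_field R R[i].

Section Subspaces.
Context {K : numFieldType} {X : lmodType K}.
Implicit Types M E : set X.

Definition linear_subspace M : Prop := GRing.submod_closed [in M].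

Definition span_of (n : nat) (e : 'I_n -> X) : set X :=
  [set x | exists a : 'I_n -> K, x = \sum_(i < n) a i *: e i].

Definition finite_dimensional M : Prop :=
  exists (n : nat) (e : 'I_n -> X), M = span_of e.

Definition infinite_dimensional M : Prop := ~ finite_dimensional M.

(* X / E is spanned by the classes of finitely many vectors. *)
Definition finite_codimensional E : Prop :=
  exists (n : nat) (e : 'I_n -> X),
    forall x : X, exists2 y : X, span_of e y & E (x - y).

Definition seminorm (p : X -> K) : Prop :=
  [/\ forall x, 0 <= p x,
      forall (a : K) (x : X), p (a *: x) = `|a| * p x
    & forall x y, p (x + y) <= p x + p y].

Definition ker_seminorm (p : X -> K) : set X := [set x | p x = 0].

Definition increasing_seminorms (p : nat -> X -> K) : Prop :=
  (forall n, seminorm (p n)) /\ (forall n x, p n x <= p n.+1 x).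

End Subspaces.

Section LocallyConvexSpaces.
Context {K : numFieldType}.

(* Since the sequence is increasing, the balls of the single seminorms
   already form a neighbourhood basis (no finite intersections needed). *)
Definition topology_given_by (X : topologicalLmodType K) (p : nat -> X -> K)
    : Prop :=
  forall (x : X) (U : set X), nbhs x U <->
    exists (n : nat) (e : K), 0 < e /\ [set y | p n (y - x) < e] `<=` U.

(* Cauchy for the translation-invariant uniformity of X. *)
Definition tvs_cauchy (X : topologicalLmodType K) (u : nat -> X) : Prop :=
  forall U : set X, nbhs 0 U -> \forall m & n \near \oo, U (u m - u n).

Definition frechet_space (X : topologicalLmodType K) : Prop :=
  [/\ hausdorff_space X,
      exists p : nat -> X -> K, increasing_seminorms p /\ topology_given_by p
    & forall u : nat -> X, tvs_cauchy u -> exists x : X, u @ \oo --> x].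

Definition continuous_norm (X : topologicalLmodType K) (p : X -> K) : Prop :=
  [/\ seminorm p, continuous p & ker_seminorm p = [set 0]].

End LocallyConvexSpaces.

Definition separable (Y : topologicalType) : Prop :=
  exists D : set Y, countable D /\ dense D.

(* Sequences are indexed by nat, so T 0, p 0, q 0 are the first terms. *)
Section Hypercyclicity.
Context {K : numFieldType} {X Y : topologicalLmodType K}.
Variable T : nat -> {linear X -> Y}.

Definition hypercyclic_vector (x : X) : Prop := dense (range (fun k => T k x)).

Definition hypercyclic_subspace (M : set X) : Prop :=
  [/\ linear_subspace M, closed M, infinite_dimensional M
    & forall x, M x -> x != 0 -> hypercyclic_vector x].

Definition hypercyclic_subspace_type2 (M : set X) : Prop :=
  hypercyclic_subspace M /\
  forall p : X -> K, seminorm p -> continuous p ->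
    infinite_dimensional (M `&` ker_seminorm p).

(* The vectors x with #{k : q (T k x) = 0} = oo. *)
Definition often_null (q : Y -> K) : set X :=
  [set x | infinite_set [set k | q (T k x) = 0]].

End Hypercyclicity.

(* Main.v *)
Require Import Defs.
From mathcomp Require Import all_boot all_order all_algebra.
From mathcomp Require Import all_classical all_reals all_analysis.

(** Let M be a hypercyclic subspace of type 2 and let U be a nonempty open set
missed by T_k (ker p_N /\ E /\ X_j) for every k >= k0.

The orbit of a nonzero x in M is dense, and so is each of its tails
([dense_tail]): the orbit enters U at some k >= k0. Hence a nonzero x in
M /\ ker p_N /\ E is not in X_j, which says that q_j (T_k x) <> 0 for all large
k. Such vectors exist inside every ker p_m: M /\ ker p_m is
infinite-dimensional, and an infinite-dimensional subspace meets a subspace of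
finite codimension outside 0 ([finite_dimensional_of_finite_codimensional]).

Choose in this way nonzero e_n in M with p_n (e_n) = 0 and with
q_j (T_k e_n) <> 0 for k >= kappa_n. Since every seminorm p_m vanishes on all
e_n with n >= m, the series \sum_n a_n e_n converges in X whatever the scalars
a_n are ([cvg_of_vanishing_steps]). The a_n can therefore be taken as large as
one likes, each one depending on the preceding ones, and this freedom yields an
x in M with q_j (T_k x) >= 1 for every k >= kappa_0 ([exists_orbit_ge1]).
Then x is nonzero, but the tail of its orbit avoids the open set
{y | q_j y < 1}, which contains 0: a contradiction. *)

Set Implicit Arguments.
Unset Strict Implicit.
Unset Printing Implicit Defensive.

Import Order.TTheory GRing.Theory Num.Theory.
Import numFieldNormedType.Exports.

Local Open Scope classical_set_scope.
Local Open Scope ring_scope.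

(** * Subspaces of finite dimension and of finite codimension *)

Section LinearAlgebra.
Context {K : numFieldType} {X : lmodType K}.
Implicit Types E F : set X.

Lemma linear_subspaceP F : linear_subspace F ->
  F 0 /\ forall a x y, F x -> F y -> F (a *: x + y).
Proof.
move=> [F0 Flin]; split; first by rewrite inE in F0.
by move=> a x y Fx Fy; apply/set_mem/Flin; exact/mem_set.
Qed.

Lemma linear_subspace_sum F (I : Type) (r : seq I) (a : I -> K) (x : I -> X) :
  linear_subspace F -> (forall i, F (x i)) -> F (\sum_(i <- r) a i *: x i).
Proof.
move=> /linear_subspaceP[F0 Flin] Fx.
by elim/big_ind : _ => // [u v Fu Fv|i _];
  [rewrite -[u]scale1r; exact: Flin|rewrite -[_ *: _]addr0; exact: Flin].
Qed.

Lemma linear_subspaceI E F :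
  linear_subspace E -> linear_subspace F -> linear_subspace (E `&` F).
Proof.
move=> /linear_subspaceP[E0 Elin] /linear_subspaceP[F0 Flin].
split; first by rewrite inE.
by move=> a x y /set_mem[Ex Fx] /set_mem[Ey Fy]; apply/mem_set; split;
  [exact: Elin|exact: Flin].
Qed.

(** F embeds into X / E as it meets E only in 0, and X / E is spanned by n
vectors. The proof makes this concrete: the coordinate rows in K^n of the
classes of the elements of F form a subspace of K^n, and each such row comes
from a single element of F. A matrix of maximal rank whose rows are coordinate
rows spans that subspace, and the lifts of its rows to F span F. *)
Lemma finite_dimensional_of_finite_codimensional E F :
  linear_subspace E -> linear_subspace F -> finite_codimensional E ->
  (forall x, E x -> F x -> x = 0) -> finite_dimensional F.
Proof.
move=> /linear_subspaceP[E0 Elin] Fsub [n [e codimE]] EF0.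
have [F0 Flin] := linear_subspaceP Fsub.
(* [lift a x]: a is a row of coordinates of the class of x modulo E. *)
pose lift (a : 'rV[K]_n) x := F x /\ E (x - \sum_i a ord0 i *: e i).
have liftD c a b x y : lift a x -> lift b y -> lift (c *: a + b) (c *: x + y).
  move=> [Fx Ex] [Fy Ey]; split; first exact: Flin.
  rewrite (_ : _ - _ = c *: (x - \sum_i a ord0 i *: e i)
                       + (y - \sum_i b ord0 i *: e i)); first exact: Elin.
  rewrite scalerBr addrACA -opprD; congr (_ - _).
  rewrite scaler_sumr -big_split /=; apply: eq_bigr => i _.
  by rewrite !mxE scalerDl scalerA.
have lift0 : lift 0 0.
  split => //; rewrite sub0r big1 ?oppr0// => i _.
  by rewrite mxE scale0r.
have lift_inj a x y : lift a x -> lift a y -> x = y.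
  move=> ax ay; apply/eqP; rewrite -subr_eq0; apply/eqP.
  have := liftD (-1) _ _ _ _ ay ax.
  rewrite !scaleN1r !addNr addrC => -[FB].
  rewrite big1 ?subr0; last by move=> i _; rewrite mxE scale0r.
  by move=> EB; exact: EF0.
have lift_mul m (A : 'M[K]_(m, n)) (u : 'rV_m) (x : 'I_m -> X) :
    (forall i, lift (row i A) (x i)) ->
    lift (u *m A) (\sum_i u ord0 i *: x i).
  move=> Ax; rewrite mulmx_sum_row.
  apply: (big_rec2 lift) => // i y1 y2 _ H.
  exact: liftD.
pose good r := `[< exists2 A : 'M[K]_n,
  (forall i, exists x, lift (row i A) x) & \rank A = r >].
have good0 : exists r, good r.
  exists 0%N; apply/asboolP; exists 0; last by rewrite mxrank0.
  by move=> i; exists 0; rewrite row0.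
have good_le r : good r -> (r <= n)%N.
  by move=> /asboolP[A _ <-]; exact: rank_leq_row.
case: (ex_maxnP good0 good_le) => r /asboolP[A /choice[x Ax] rA] rmax.
exists n, x; apply/seteqP; split => [y Fy|_ [a ->]]; last first.
  by apply: linear_subspace_sum => // i; case: (Ax i).
have [_ [b ->] Eyb] := codimE y.
pose a := \row_i b i.
have ay : lift a y.
  by split => //; under eq_bigr do rewrite mxE.
(* By maximality of the rank of A, adding the row a to A adds nothing to its
   row space. *)
have /submxP[u au] : (a <= A)%MS.
  apply: submx_trans (addsmxSr A a) _.
  rewrite -(mxrank_leqif_sup (addsmxSl A a)) eqn_leq mxrankS ?addsmxSl//= rA.
  apply: rmax; apply/asboolP; exists (A + a)%MS => // i.
  have /sub_addsmxP[[u v] /= ->] := row_sub i (A + a)%MS.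
  exists (v ord0 ord0 *: y + \sum_i u ord0 i *: x i).
  rewrite addrC [v *m a]mulmx_sum_row big_ord1 row_id.
  by apply: liftD => //; exact: lift_mul.
exists (fun i => u ord0 i); apply: lift_inj ay _.
by rewrite au; exact: lift_mul.
Qed.

End LinearAlgebra.

(** * Seminorms and the topology that they give *)

Section Seminorms.
Context {K : numFieldType} {X : lmodType K} {p : X -> K}.
Context (hp : seminorm p).

Lemma seminorm_ge0 x : 0 <= p x. Proof. by case: hp. Qed.

Lemma seminormZ a x : p (a *: x) = `|a| * p x. Proof. by case: hp. Qed.

Lemma seminormD x y : p (x + y) <= p x + p y. Proof. by case: hp. Qed.

Lemma seminorm0 : p 0 = 0.
Proof. by rewrite -(scale0r 0) seminormZ normr0 mul0r. Qed.

Lemma seminormN x : p (- x) = p x.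
Proof. by rewrite -scaleN1r seminormZ normrN1 mul1r. Qed.

Lemma seminorm_distC x y : p (x - y) = p (y - x).
Proof. by rewrite -seminormN opprB. Qed.

Lemma seminormB_le x y : p x <= p y + p (x - y).
Proof. by rewrite -{1}(subrKC y x) seminormD. Qed.

Lemma seminorm_dist_le x y : `|p x - p y| <= p (x - y).
Proof.
rewrite real_ler_norml ?realB ?ger0_real ?seminorm_ge0//.
rewrite lerNl opprB !lerBlDl seminormB_le /=.
by rewrite seminorm_distC seminormB_le.
Qed.

Lemma seminorm_gt0 x : (0 < p x) = (p x != 0).
Proof. by rewrite lt0r seminorm_ge0 andbT. Qed.

Lemma seminormD_ker x y : p y = 0 -> p (x + y) = p x.
Proof.
move=> py0; apply/eqP; rewrite -subr_eq0 -normr_le0.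
by rewrite (le_trans (seminorm_dist_le _ _))// addrC addKr py0.
Qed.

Lemma linear_subspace_ker : linear_subspace (ker_seminorm p).
Proof.
split; first by rewrite inE /ker_seminorm /= seminorm0.
move=> a x y /set_mem xk /set_mem yk; apply/mem_set.
by rewrite /ker_seminorm /= seminormD_ker// seminormZ xk mulr0.
Qed.

End Seminorms.

Lemma increasing_seminorms_le {K : numFieldType} {X : lmodType K}
    {p : nat -> X -> K} : increasing_seminorms p ->
  forall m n x, (m <= n)%N -> p m x <= p n x.
Proof.
move=> [_ pS] m n x; elim: n => [|n IH]; first by rewrite leqn0 => /eqP ->.
by rewrite leq_eqVlt => /predU1P[->//|/IH mn]; exact: le_trans (pS n x).
Qed.

Section Topology.
Context {K : numFieldType} {X : topologicalLmodType K} {p : nat -> X -> K}.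
Context (hp : increasing_seminorms p) (hXp : topology_given_by p).

Lemma seminorm_continuous n : continuous (p n).
Proof.
move=> x; apply/cvgrPdist_lt => e e0; apply/hXp; exists n, e; split => //.
move=> y /=; apply: le_lt_trans; rewrite distrC.
exact: (seminorm_dist_le (hp.1 n)).
Qed.

Lemma open_seminorm_lt n c : open [set x | p n x < c].
Proof.
rewrite openE => x /= pxc; apply/hXp.
exists n, (c - p n x); rewrite subr_gt0; split => // y /=.
by rewrite ltrBrDl; apply: le_lt_trans; exact: (seminormB_le (hp.1 n)).
Qed.

Lemma open_seminorm_neq0 n d : open [set x | p n (x - d) != 0].
Proof.
rewrite openE => x /= pxd; apply/hXp.
have hn := hp.1 n.
exists n, (p n (x - d)); rewrite (seminorm_gt0 hn); split => // y /=.
apply: contraTneq => pyd; rewrite (seminorm_distC hn).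
by rewrite -(subrKA d) (seminormD_ker hn) ?ltxx// (seminorm_distC hn) pyd.
Qed.

End Topology.

(** * Orbits *)

(** If all q_n are zero, then Y is indiscrete and f k0 lies in every nonempty
open set. Otherwise some q_n is nonzero, and deleting one point d from a dense
set leaves it dense: an open set that contains d also contains points at
positive q_n-distance from d, and these points form an open set. *)
Lemma dense_tail {K : numFieldType} {Y : topologicalLmodType K}
    {q : nat -> Y -> K} (f : nat -> Y) :
  increasing_seminorms q -> topology_given_by q -> dense (range f) ->
  forall (k0 : nat) (O : set Y), O !=set0 -> open O ->
  exists2 k, (k0 <= k)%N & O (f k).
Proof.
move=> hq hYq fdense.
have [[n [y0 qy0]]|noq] := pselect (exists n y, q n y != 0); last first.
  have q0 n z : q n z = 0.
    by apply: contrapT => /eqP qz; apply: noq; exists n, z.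
  move=> k0 O [y Oy] Oopen; exists k0 => //.
  have /hYq[n [e [e0]]] : nbhs y O by exact: open_nbhs_nbhs.
  by apply; rewrite /= q0.
have avoid d (O : set Y) : O !=set0 -> open O ->
    O `&` [set y | q n (y - d) != 0] !=set0.
  move=> [u Ou] Oopen; have [ud|ud] := eqVneq (q n (u - d)) 0; last by exists u.
  have /hYq[m [e [e0 eO]]] : nbhs u O by exact: open_nbhs_nbhs.
  have q1 : 0 < 1 + q m y0 by rewrite ltr_pwDl// (seminorm_ge0 (hq.1 m)).
  have t0 : 0 < e / (1 + q m y0) by rewrite divr_gt0.
  (* This multiple of y0 has q_m-seminorm below the radius e. *)
  exists (u + (e / (1 + q m y0)) *: y0); split.
    apply: eO => /=; rewrite addrC addKr (seminormZ (hq.1 m)) gtr0_norm//.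
    by rewrite mulrAC ltr_pdivrMr// ltr_pM2l// ltrDr ltr01.
  rewrite /= addrAC [_ + _ *: _]addrC (seminormD_ker (hq.1 n))//.
  by rewrite (seminormZ (hq.1 n)) mulf_neq0// normr_eq0 gt_eqF.
elim=> [|k0 IH] O O0 Oopen.
  by have [y [Oy [k _ fk]]] := fdense O O0 Oopen; exists k; rewrite // fk.
have [] := IH _ (avoid (f k0) O O0 Oopen).
  by apply: openI => //; exact: (open_seminorm_neq0 hq hYq).
move=> k; rewrite leq_eqVlt => /predU1P[<-|k0k] [Ofk /=]; last by exists k.
by rewrite subrr (seminorm0 (hq.1 n)) eqxx.
Qed.

(** Finitely many lower bounds on |a| suffice; a is taken to be the sum of them.
The indices k with q (T_k e) = 0 contribute 0 to this sum since 0^-1 = 0. *)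
Lemma exists_scalar_ge1 {K : numFieldType} {X Y : lmodType K} (q : Y -> K)
    (T : nat -> {linear X -> Y}) (s e : X) (b : nat) : seminorm q ->
  exists a : K, forall k, (k <= b)%N -> q (T k e) != 0 ->
    1 <= q (T k (s + a *: e)).
Proof.
move=> hq; pose c k := (1 + q (T k s)) / q (T k e).
have c0 k : 0 <= c k.
  by rewrite divr_ge0 ?addr_ge0 ?(seminorm_ge0 hq).
exists (\sum_(i < b.+1) c i) => k kb qe.
have le_c : c k <= \sum_(i < b.+1) c i.
  by rewrite (bigD1 (Ordinal (kb : (k < b.+1)%N)))//= lerDl sumr_ge0.
have : 1 + q (T k s) <= q (T k ((\sum_(i < b.+1) c i) *: e)).
  rewrite linearZ (seminormZ hq) ger0_norm ?sumr_ge0//.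
  by rewrite -ler_pdivrMr// (seminorm_gt0 hq).
move=> /le_trans/(_ (seminormB_le hq _ (- T k s))).
by rewrite (seminormN hq) opprK addrC lerD2l -linearD addrC.
Qed.

(** A given seminorm p_n does not see the steps of index at least n, so the
sequence is eventually constant for p_n, hence Cauchy. *)
Lemma cvg_of_vanishing_steps {K : numFieldType} {X : topologicalLmodType K}
    {p : nat -> X -> K} (s : nat -> X) :
  increasing_seminorms p -> topology_given_by p -> frechet_space X ->
  (forall n, p n (s n.+1 - s n) = 0) -> exists x : X, s @ \oo --> x.
Proof.
move=> hp hXp [_ _ complete] ps; apply: complete => U /(hXp 0 U)[n [e [e0 eU]]].
have hn := hp.1 n.
have pn i : p n (s (n + i)%N - s n) = 0.
  elim: i => [|i IH]; first by rewrite addn0 subrr (seminorm0 hn).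
  rewrite addnS -(subrKA (s (n + i)%N)) (seminormD_ker hn)//.
  apply/le_anti; rewrite (seminorm_ge0 hn) andbT -(ps (n + i)%N).
  exact/(increasing_seminorms_le hp)/leq_addr.
near=> i j; apply: eU => /=; rewrite subr0.
have ni : (n <= i)%N by near: i; exact: nbhs_infty_ge.
have nj : (n <= j)%N by near: j; exact: nbhs_infty_ge.
rewrite -(subnKC ni) -(subnKC nj) -(subrKA (s n)) (seminormD_ker hn) ?pn//.
by rewrite (seminorm_distC hn) pn.
Unshelve. all: by end_near. Qed.

(** The vector x is the sum of a series of multiples of the e_n. The coefficient
of e_n is chosen after the partial sum s_n, so large that
q_j (T_k s_(n+1)) >= 1 for each of the finitely many k <= b_n with
q_j (T_k e_n) <> 0. Later terms do not destroy this bound: at stage m > n,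
either q_j (T_k e_m) = 0 and the value is unchanged, or the choice of the m-th
coefficient enforces the bound again, as b is nondecreasing. Since moreover
b_n >= kappa_(n+1), the intervals [kappa_n, b_n] cover all k >= kappa_0, so for
each such k the bound holds from some stage on, and it passes to the limit. *)
Lemma exists_orbit_ge1 {K : numFieldType} {X Y : topologicalLmodType K}
    {p : nat -> X -> K} {q : nat -> Y -> K} (T : nat -> {linear X -> Y})
    (M : set X) (j : nat) (e : nat -> X) (kappa : nat -> nat) :
  increasing_seminorms p -> topology_given_by p -> frechet_space X ->
  increasing_seminorms q -> topology_given_by q ->
  (forall k, continuous (T k)) -> linear_subspace M -> closed M ->
  (forall n, M (e n)) -> (forall n, p n (e n) = 0) ->
  (forall n k, (kappa n <= k)%N -> q j (T k (e n)) != 0) ->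
  exists2 x, M x & forall k, (kappa 0 <= k)%N -> 1 <= q j (T k x).
Proof.
move=> hp hXp hX hq hYq hT Msub Mclosed Me pe qe.
have [M0 Mlin] := linear_subspaceP Msub.
pose b n := (n + \sum_(i < n.+2) kappa i)%N.
have bS n : (b n <= b n.+1)%N.
  by rewrite /b [X in (_ <= _ + X)%N]big_ord_recr /= leq_add// leq_addr.
have kappa_b n : (kappa n.+1 <= b n)%N.
  by rewrite /b big_ord_recr /= addnA leq_addl.
have b_ge n : (n <= b n)%N by exact: leq_addr.
have /choice[a ha] : forall z : X * nat, exists c, forall k, (k <= b z.2)%N ->
    q j (T k (e z.2)) != 0 -> 1 <= q j (T k (z.1 + c *: e z.2)).
  by move=> [s n]; exact: exists_scalar_ge1 (hq.1 j).
pose s := fix s n := if n is m.+1 then s m + a (s m, m) *: e m else 0.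
have [x sx] : exists x : X, s @ \oo --> x.
  apply: (cvg_of_vanishing_steps hp hXp hX) => n /=.
  by rewrite addrC addKr (seminormZ (hp.1 n)) pe mulr0.
exists x.
  apply: (closed_cvg M) sx => //; apply: nearW.
  by elim=> [|n IH] //=; rewrite addrC; exact: Mlin.
move=> k k0.
have [n [nk kb]] : exists n, (kappa n <= k)%N /\ (k <= b n)%N.
  have [n kb nmin] := ex_minnP (ex_intro (fun n => k <= b n)%N k (b_ge k)).
  exists n; split => //; case: n nmin {kb} => // n nmin.
  rewrite (leq_trans (kappa_b n))// ltnW// ltnNge.
  by apply/negP => /nmin; rewrite ltnn.
have qs i : 1 <= q j (T k (s (n + i).+1)).
  have kbi m : (k <= b (n + m))%N.
    elim: m => [|m IH]; first by rewrite addn0.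
    by rewrite addnS (leq_trans IH).
  elim: i => [|i IH].
    by rewrite addn0; apply: (ha (s n, n)) => //; exact: qe.
  rewrite addnS.
  have [qe0|qe0] := eqVneq (q j (T k (e (n + i).+1))) 0; last first.
    by apply: (ha (s (n + i).+1, (n + i).+1)) => //=; rewrite -addnS.
  rewrite [s _.+2]/= linearD (seminormD_ker (hq.1 j))//.
  by rewrite linearZ (seminormZ (hq.1 j)) qe0 mulr0.
rewrite real_leNgt ?ger0_real ?ler01 ?(seminorm_ge0 (hq.1 j))//.
apply/negP => qx.
have [m _ /(_ (n + m).+1)] : \forall i \near \oo, q j (T k (s i)) < 1.
  have Tsx : (T k \o s) @ \oo --> T k x by exact: (cvg_comp _ _ sx (hT k x)).
  apply: (Tsx [set y | q j y < 1]); apply: open_nbhs_nbhs; split => //.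
  exact: (open_seminorm_lt hq hYq).
rewrite /= (leqW (leq_addl n m)) => /(_ isT) /lt_le_trans/(_ (qs m)).
by rewrite ltxx.
Qed.

(** * Hypercyclic subspaces of type 2 *)

Unset Implicit Arguments.

Theorem theorem3p6 (R : realType) (K : numFieldType) (hK : scalar_field R K)
  (X : topologicalLmodType K) (Y : topologicalLmodType K)
  (hXdim : infinite_dimensional [set: X])
  (hXfrechet : frechet_space X)
  (hXnonorm : ~ exists p : X -> K, continuous_norm p)
  (p : nat -> X -> K) (hp : increasing_seminorms p)
  (hXp : topology_given_by p)
  (hYsep : separable Y)
  (q : nat -> Y -> K) (hq : increasing_seminorms q)
  (hYq : topology_given_by q)
  (T : nat -> {linear X -> Y}) (hT : forall k, continuous (T k)) :
  (exists (j N k0 : nat) (E : set X),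
    [/\ linear_subspace E, finite_codimensional E
      & ~ dense (\bigcup_(k in [set k | (k0 <= k)%N])
                   (T k @` (ker_seminorm (p N) `&` E `&` often_null T (q j))))]) ->
  ~ exists M : set X, hypercyclic_subspace_type2 T M.
Proof.
move=> [j [N [k0 [E [Esub Ecodim ndense]]]]].
move=> [M [[Msub Mclosed Minf Mhyp] Mtype2]].
move: ndense => /existsNP[U] /not_implyP[U0] /not_implyP[Uopen Uavoid].
(* Such an x is not in X_j, since its orbit enters U after k0; kappa bounds the
   finitely many k with q_j (T_k x) = 0. *)
have visible x : M x -> x != 0 -> p N x = 0 -> E x ->
    exists kappa, forall k, (kappa <= k)%N -> q j (T k x) != 0.
  move=> Mx x0 px Ex; apply: contrapT => nkappa; apply: Uavoid.
  have [k k0k Uk] := dense_tail hq hYq (Mhyp x Mx x0) k0 U0 Uopen.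
  exists (T k x); split => //; exists k => //; exists x => //; split => //.
  move=> /finite_seqP[r nullr]; apply: nkappa.
  exists (\max_(i <- r) i).+1 => i; apply: contraTN => /eqP qi.
  rewrite -leqNgt; apply: (@leq_bigmax_seq _ r xpredT id) => //.
  by have : [set i | q j (T i x) = 0] i by []; rewrite nullr.
have pick m : exists z : X * nat, [/\ M z.1, z.1 != 0, p m z.1 = 0
    & forall k, (z.2 <= k)%N -> q j (T k z.1) != 0].
  pose F := M `&` ker_seminorm (p (maxn m N)).
  have Fsub : linear_subspace F.
    by apply: linear_subspaceI => //; exact: linear_subspace_ker (hp.1 _).
  have [x [Mx px Ex x0]] : exists x, [/\ M x, p (maxn m N) x = 0, E x & x != 0].
    apply: contrapT => nox.
    apply: (Mtype2 (p (maxn m N))).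
    - exact: hp.1.
    - exact: (seminorm_continuous hp hXp).
    apply: (finite_dimensional_of_finite_codimensional Esub Fsub Ecodim).
    move=> x Ex [Mx px]; apply: contrapT => /eqP x0.
    by apply: nox; exists x.
  have p0 i : (i <= maxn m N)%N -> p i x = 0.
    move=> im; apply/le_anti; rewrite (seminorm_ge0 (hp.1 i)) andbT -px.
    exact: (increasing_seminorms_le hp).
  have [kappa qk] := visible x Mx x0 (p0 N (leq_maxr m N)) Ex.
  by exists (x, kappa); split => //=; exact/p0/leq_maxl.
have [z hz] := choice pick.
have [x Mx qx] : exists2 x, M x &
    forall k, ((z 0).2 <= k)%N -> 1 <= q j (T k x).
  apply: (exists_orbit_ge1 (e := fst \o z) (kappa := snd \o z)
    hp hXp hXfrechet hq hYq hT Msub Mclosed) => m /=; by have [] := hz m.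
have x0 : x != 0.
  apply/eqP => xE; have := qx _ (leqnn _).
  by rewrite xE linear0 (seminorm0 (hq.1 j)) ler10.
have [||k zk] := dense_tail hq hYq (Mhyp x Mx x0) (z 0).2
  (O := [set y | q j y < 1]).
- by exists 0; rewrite /= (seminorm0 (hq.1 j)) ltr01.
- exact: (open_seminorm_lt hq hYq).
by move=> /= /(le_lt_trans (qx k zk)); rewrite ltxx.
Qed.
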